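(* Let $X, X_1,X_2,\dots$ be i.i.d. $[0,1]$-valued random variables with $\mathrm{P}(X=0)<1$. Then for all $t>0$, $$M(t)-V(t)\le \limsup_{n\to\infty} b_n .$$
   Context: Let $S_1<S_2<\cdots$ be the arrival times of a homogeneous Poisson process with rate $\lambda=1$ on $(0,\infty)$, independent of the sequence $X_1,X_2,\dots$; the value $X_k$ is observed at time $S_k$. Let $N(t)$ be the number of arrivals up to time $t$, i.e. $N(t)=\max\{k\ge 0: S_k\le t\}$ with $S_0=0$. Define $$M(t):=\mathrm{E}\big(\max\{X_1,\dots,X_{N(t)}\}\big),$$ where the maximum of an empty set is taken to be $0$, and $$V(t):=\sup_{\tau\in\mathcal{T}}\mathrm{E}\big[X_\tau\,\mathrm{I}(S_\tau\le t)\big],$$ where $\mathrm{I}$ denotes an indicator and $\mathcal{T}$ is the set of all $\mathbb{N}$-valued random variables (stopping rules) $\tau$ such that, for each $i$, the event $\{\tau=i\}$ is measurable with respect to the $\sigma$-algebra generated by $(X_1,S_1),\dots,(X_i,S_i)$. The constants $b_n$, $n\ge 2$ (Hill and Kertz, 1982), are defined as follows. For $n>1$ and $w,x\in[0,\infty)$ let $$\phi_n(w,x)=\frac{n}{n-1}\,w^{(n-1)/n}+\frac{x}{n-1}.$$ For $\alpha\in[0,\infty)$ define $\eta_{0,n}(\alpha)=\phi_n(0,\alpha)$ and, inductively, $\eta_{j,n}(\alpha)=\phi_n(\eta_{j-1,n}(\alpha),\alpha)$ for $j\ge 1$. By a known result of Hill and Kertz there is a unique $\beta_n\in(0,1)$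 such that $(n-1)\,[\eta_{n,n}(\beta_n)-\eta_{n-1,n}(\beta_n)]=1$. Set $b_n:=\beta_n$. A known theorem of Hill and Kertz (1982, Theorem B) states that $b_n$ is the best constant such that $\mathrm{E}(Z_1\vee\dots\vee Z_n)-\sup_\tau \mathrm{E}Z_\tau\le b_n(b-a)$ for all i.i.d. $[a,b]$-valued $Z_1,\dots,Z_n$, the supremum being over stopping rules $\tau$ for $Z_1,\dots,Z_n$. *)

(* Defs.v *)
From HB Require Import structures.
From mathcomp Require Import all_boot all_order all_algebra.
From mathcomp Require Import all_classical all_reals all_analysis.

Set Implicit Arguments.
Unset Strict Implicit.
Unset Printing Implicit Defensive.

Import Order.TTheory GRing.Theory Num.Theory.
Import numFieldNormedType.Exports.

Local Open Scope classical_set_scope.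
Local Open Scope ring_scope.

Definition mutually_independent (d d' : measure_display)
    (T : measurableType d) (T' : measurableType d') (R : realType)
    (P : probability T R) (Y : nat -> T -> T') : Prop :=
  forall (J : seq nat) (B : nat -> set T'),
    uniq J -> (forall k, measurable (B k)) ->
    P (\bigcap_(k in [set` J]) (Y k @^-1` B k)) =
    (\prod_(k <- J) P (Y k @^-1` B k))%E.

Definition g_sigma_seq (d' : measure_display) (T : Type)
    (T' : measurableType d') (Y : nat -> T -> T') : set (set T) :=
  <<s \bigcup_k preimage_set_system setT (Y k) measurable >>.

Definition independent_seqs (d d1 d2 : measure_display)
    (T : measurableType d) (T1 : measurableType d1) (T2 : measurableType d2)
    (R : realType) (P : probability T R)
    (Y : nat -> T -> T1) (Z : nat -> T -> T2) : Prop :=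
  forall A B, g_sigma_seq Y A -> g_sigma_seq Z B ->
    P (A `&` B) = (P A * P B)%E.

Section arrivals.
Context (d : measure_display) (T : measurableType d) (R : realType).
Implicit Types (P : probability T R) (S X : nat -> T -> R).

(* The counts of the process are stated as events on the set of indices of the
   arrivals in ]a, b], so that no value has to be chosen for an infinite
   count; the process is then almost surely non-explosive. Index 0, with
   S 0 = 0, is not an arrival, and is excluded from ]a, b] since 0 <= a. *)
Definition has_arrivals S (a b : R) (c : nat) : set T :=
  [set w | ([set k | a < S k w <= b] #= `I_c)%card].

(* For rate > 0: the counts in consecutive intervals are independent Poisson
   variables, the mean being the rate times the length of the interval. *)
Definition poisson_arrivals P (rate : R) S : Prop :=
  [/\ (forall w, S 0%N w = 0),
      (forall k w, S k w < S k.+1 w) &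
      forall (m : nat) (s : nat -> R) (c : nat -> nat),
        0 <= s 0%N -> (forall j, s j < s j.+1) ->
        P (\bigcap_(j in `I_m) has_arrivals S (s j) (s j.+1) (c j)) =
        (\prod_(j < m) poisson_pmf (rate * (s j.+1 - s j)) (c j))%:E].

(* N(t) = max {k | S k <= t}; the value is 0 if this set has no maximum, which
   for a Poisson process has probability 0. *)
Definition arrival_count S (t : R) (w : T) : nat :=
  xget 0%N [set k | S k w <= t /\ (forall j, S j w <= t -> (j <= k)%N)].

(* Meant for nonnegative X, where 0 can be the neutral element of the max. *)
Definition prophet_value P X S (t : R) : \bar R :=
  'E_P[fun w => (\big[Num.max/0]_(k < arrival_count S t w) X k.+1 w)%R]%E.

Definition stopping_rule X S (tau : T -> nat) : Prop :=
  (forall w, (0 < tau w)%N) /\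
  forall i, g_sigma_preimage (fun (k : 'I_i) w => (X k.+1 w, S k.+1 w))
              (tau @^-1` [set i]).

Definition gambler_value P X S (t : R) : \bar R :=
  ereal_sup [set 'E_P[fun w => (X (tau w) w * (S (tau w) w <= t)%R%:R)%R]%E
            | tau in stopping_rule X S].

End arrivals.

Section hill_kertz.
Context (R : realType).

Definition hk_phi (n : nat) (w x : R) : R :=
  n%:R / (n%:R - 1) * w `^ ((n%:R - 1) / n%:R) + x / (n%:R - 1).

Fixpoint hk_eta (n j : nat) (alpha : R) : R :=
  if j is j'.+1 then hk_phi n (hk_eta n j' alpha) alpha else hk_phi n 0 alpha.

(* For n >= 2 such a beta exists and is unique (Hill and Kertz, 1982), so that
   xget picks it; the values at n = 0 and n = 1 are irrelevant. *)
Definition hk_const (n : nat) : R :=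
  xget 0 [set beta | 0 < beta < 1 /\
    (n%:R - 1) * (hk_eta n n beta - hk_eta n n.-1 beta) = 1].

End hill_kertz.

(* Main.v *)
(* A threshold rule on a grid of mesh h = t / n earns, up to O(1 / n), at least
   v_n, where v_0 = 0 and v_{j+1} = v_j + h E(X - v_j)^+; for this it suffices to
   count the outcomes with at most one arrival per cell of the grid.
   The prophet gets at most the integral over [0, 1] of 1 - exp (- t P(X > x)).
   On [v_j, v_{j+1}] the integrand is bounded by Bernoulli's inequality
   q^n >= n c^(n-1) q - (n-1) c^n with q = exp (- h P(X > x)) >= 1 - h P(X > x)
   and c^n = eta_{j,n}(beta). As v_{j+1} - v_j = h E(X - v_j)^+, the recursion
   of the eta_{j,n} makes the sum of these bounds telescope, and the equation
   defining b_n turns it into M(t) <= v_n + b_n. *)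

Require Import Defs.
From HB Require Import structures.
From mathcomp Require Import all_boot all_order all_algebra.
From mathcomp Require Import ring lra.
From mathcomp Require Import all_classical all_reals all_analysis.
From mathcomp Require Import measurable_realfun.

Set Implicit Arguments.
Unset Strict Implicit.
Unset Printing Implicit Defensive.

Import Order.TTheory GRing.Theory Num.Theory.
Import numFieldNormedType.Exports.

Local Open Scope classical_set_scope.
Local Open Scope ring_scope.

(** * The constants of Hill and Kertz *)

(** The constants b_n enter because a grid of n cells is close to a stopping problem with n
    independent variables, each equal to X with probability h and to 0 otherwise; v_j is its optimal
    value when j variables remain. The bound on the prophet is weak duality: the tangent points in
    Bernoulli's inequality act as multipliers, and the recursion of the eta_{j,n} is the condition
    under which the unknown tail of X cancels between neighbouring intervals. On the probability
    side, the Poisson hypothesis speaks only of counts in consecutive intervals, and no conditional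
    expectation is formed. Rewards are integrated over events that fix the count of every cell and
    the outcome of the first m comparisons with a threshold. Such an event is independent of
    X_{m+1}, X_{m+2}, ..., and the induction carries this property along. Explosion has probability
    0 but may occur at single outcomes, so the statements about one outcome allow for it. *)

Section hill_kertz_constants.
Context (R : realType).
Implicit Types (n k : nat) (a b q c w : R).

(** Convexity: the graph of the power lies above its tangent at c. In the induction, the difference
    for k + 1 is q times the difference for k plus a multiple of (q - c)^2. *)
Lemma exprn_ge_tangent k q c : 0 <= q -> 0 <= c ->
  k.+1%:R * c ^+ k * q - k%:R * c ^+ k.+1 <= q ^+ k.+1.
Proof.
move=> q0 c0; elim: k => [|k IH]; first by rewrite expr0 expr1; lra.
rewrite -subr_ge0.
have -> : q ^+ k.+2 - (k.+2%:R * c ^+ k.+1 * q - k.+1%:R * c ^+ k.+2) =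
    q * (q ^+ k.+1 - (k.+1%:R * c ^+ k * q - k%:R * c ^+ k.+1)) +
    k.+1%:R * c ^+ k * (q - c) ^+ 2.
  by rewrite -(natr1 k.+1) -(natr1 k) !exprS; ring.
by apply: addr_ge0; rewrite mulr_ge0 ?subr_ge0 ?sqr_ge0// mulr_ge0 ?exprn_ge0.
Qed.

Lemma hk_phi_ge0 n w a : (1 < n)%N -> 0 <= w -> 0 <= a -> 0 <= hk_phi n w a.
Proof.
move=> n1 w0 a0; have N1 : (1 : R) < n%:R by rewrite ltr1n.
rewrite /hk_phi addr_ge0 ?mulr_ge0 ?powR_ge0 ?invr_ge0//; lra.
Qed.

Lemma hk_eta_ge0 n j a : (1 < n)%N -> 0 <= a -> 0 <= hk_eta n j a.
Proof. by move=> n1 a0; elim: j => [|j IH]; exact: hk_phi_ge0. Qed.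

(** Taking c = w^(1/n) as tangent point turns the fractional power in [hk_phi] into the integer
    powers of the tangent bound. *)
Lemma powR_root_expr n w : (1 < n)%N -> 0 <= w ->
  let c := w `^ n%:R^-1 in c ^+ n = w /\ c ^+ n.-1 = w `^ ((n%:R - 1) / n%:R).
Proof.
move=> n1 w0 /=; rewrite -!powR_mulrn ?powR_ge0// -!powRrM.
have n0 : (n%:R : R) != 0 by rewrite pnatr_eq0 -lt0n (ltn_trans _ n1).
rewrite mulVf// powRr1//; split=> //; congr powR.
by rewrite mulrC -subn1 natrB// ltnW.
Qed.

Lemma hk_etaS n j a : (1 < n)%N ->
  (n%:R - 1) * hk_eta n j.+1 a =
  n%:R * hk_eta n j a `^ ((n%:R - 1) / n%:R) + a.
Proof.
move=> n1; have N1 : (1 : R) < n%:R by rewrite ltr1n.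
by rewrite /= /hk_phi; field; lra.
Qed.

Lemma hk_eta0 n a : (1 < n)%N -> (n%:R - 1) * hk_eta n 0 a = a.
Proof.
move=> n1; have N1 : (1 : R) < n%:R by rewrite ltr1n.
rewrite /= /hk_phi powR0; last by rewrite gt_eqF// divr_gt0//; lra.
by field; lra.
Qed.

(** * The duality bound, for an abstract tail with primitive G *)

Section dual_certificate.
Context (n : nat) (h beta : R) (I G : R -> R) (v : nat -> R).
Hypotheses (n1 : (1 < n)%N) (beta0 : 0 <= beta).
Hypothesis beta_eq : (n%:R - 1) * (hk_eta n n beta - hk_eta n n.-1 beta) = 1.
Hypothesis tangent : forall c a b, 0 <= c -> 0 <= a -> a <= b -> b <= 1 ->
  n%:R * c ^+ n.-1 * ((b - a) - h * (G b - G a)) -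
  (n%:R - 1) * c ^+ n * (b - a) <= I b - I a.
Hypotheses (I0 : I 0 = 0) (v0 : v 0%N = 0).
Hypothesis vS : forall j, v j.+1 = v j + h * (G 1 - G (v j)).
Hypotheses (v_ge0 : forall j, 0 <= v j) (v_le1 : forall j, v j <= 1).
Hypothesis v_nd : forall j, v j <= v j.+1.

Let u j := h * (G 1 - G (v j)).

(** As u_j = v_{j+1} - v_j, this bounds I (v_j) from below by the sum of the tangent bounds up to
    v_j. The term in eta_j u_j is the one that the tangent bound on [v_j, v_{j+1}] cancels. *)
Lemma dual_certificate_step j :
  (n%:R - 1) * hk_eta n j beta * u j - beta * v j - beta * u j <= I (v j).
Proof.
elim: j => [|j IH]; first by rewrite hk_eta0// v0 I0; lra.
have e0 := hk_eta_ge0 j n1 beta0.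
have [cn cn1] := powR_root_expr n1 e0.
have := tangent (powR_ge0 (hk_eta n j beta) n%:R^-1) (v_ge0 j) (v_nd j) (v_le1 j.+1).
rewrite cn cn1 => H; have E := hk_etaS j beta n1; move: H.
(* The recursion of v makes this part of the tangent bound the next increment u_{j+1}. *)
have -> : v j.+1 - v j - h * (G (v j.+1) - G (v j)) = u j.+1.
  by rewrite /u vS; ring.
have vuS : v j.+1 = v j + u j by exact: vS.
have -> : v j.+1 - v j = u j by rewrite vuS; ring.
have -> : n%:R * hk_eta n j beta `^ ((n%:R - 1) / n%:R) =
   (n%:R - 1) * hk_eta n j.+1 beta - beta by rewrite E; ring.
by move: IH; rewrite vuS; lra.
Qed.

Lemma dual_certificate_bound : 1 - I 1 <= v n + beta.
Proof.
have e0 := hk_eta_ge0 n.-1 n1 beta0.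
have [cn cn1] := powR_root_expr n1 e0.
(* The tangent point of [v_{n-1}, v_n] serves again on the last interval [v_n, 1]; the factor of 1 -
   v_n then contains eta_n - eta_{n-1}, which the equation for [beta] evaluates. *)
have := tangent (powR_ge0 (hk_eta n n.-1 beta) n%:R^-1) (v_ge0 n) (v_le1 n) (lexx 1).
rewrite cn cn1; have E := hk_etaS n.-1 beta n1.
rewrite prednK ?(ltn_trans _ n1)// in E.
have -> : n%:R * hk_eta n n.-1 beta `^ ((n%:R - 1) / n%:R) =
   (n%:R - 1) * hk_eta n n beta - beta by rewrite E; ring.
have := dual_certificate_step n; rewrite /u => H1 H2.
have H3 : (n%:R - 1) * (hk_eta n n beta - hk_eta n n.-1 beta) * (1 - v n) =
  1 - v n by rewrite beta_eq mul1r.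
by move: H1 H2 H3; lra.
Qed.

End dual_certificate.

(* powR is discontinuous at 0 from the left, as ln is 0 on negative numbers. *)
Lemma continuous_powR_max (p : R) : 0 < p ->
  continuous (fun w : R => Num.max w 0 `^ p).
Proof.
move=> p0 x; have [x0|x0] := ltP 0 x.
- apply: (@cvg_trans _ ((fun w => expR (p * ln w)) @ x)).
    apply: near_eq_cvg; near=> y.
    have y0 : 0 < y by near: y; exact: lt_nbhsr.
    by rewrite max_l ?ltW// /powR gt_eqF.
  rewrite max_l ?(ltW x0)// /powR gt_eqF//.
  have H : p * ln w @[w --> x] --> p * ln x.
    by apply: cvgMr; exact: continuous_ln.
  exact: (cvg_comp _ _ H (@continuous_expR R _)).
- rewrite /continuous_at (max_r x0) powR0 ?gt_eqF//; apply/cvgrPdist_lt => e e0.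
  near=> y; rewrite sub0r normrN ger0_norm ?powR_ge0//.
  have ye : y < e `^ p^-1.
    by near: y; apply: lt_nbhsl; rewrite (le_lt_trans x0)// powR_gt0.
  have -> : e = (e `^ p^-1) `^ p.
    by rewrite -powRrM mulVf ?gt_eqF// powRr1// ltW.
  apply: gt0_ltr_powR; rewrite ?nnegrE ?powR_ge0// ?le_max ?lexx ?orbT//.
  by rewrite gt_max ye powR_gt0.
Unshelve. all: by end_near. Qed.

(** The truncation makes [hk_eta] continuous on the whole line without changing it for a >= 0, so
    that the intermediate value theorem applies. *)
Fixpoint hk_eta_max n j a : R :=
  if j is j'.+1 then n%:R / (n%:R - 1) *
    Num.max (hk_eta_max n j' a) 0 `^ ((n%:R - 1) / n%:R) + a / (n%:R - 1)
  else a / (n%:R - 1).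

Lemma hk_eta_maxE n j a : (1 < n)%N -> 0 <= a ->
  hk_eta_max n j a = hk_eta n j a.
Proof.
move=> n1 a0; have N1 : (1 : R) < n%:R by rewrite ltr1n.
elim: j => [|j IH] /=.
  by rewrite /hk_phi powR0 ?mulr0 ?add0r// gt_eqF// divr_gt0//; lra.
by rewrite IH max_l// hk_eta_ge0.
Qed.

Lemma continuous_hk_eta_max n j : (1 < n)%N -> continuous (hk_eta_max n j).
Proof.
move=> n1; have N1 : (1 : R) < n%:R by rewrite ltr1n.
have p0 : 0 < (n%:R - 1) / n%:R :> R by rewrite divr_gt0//; lra.
have cl : continuous (fun a : R => a / (n%:R - 1)).
  by move=> x; apply: cvgMl; exact: cvg_id.
elim: j => [//|j IH] x /=.
have H := cvg_comp _ _ (IH x) (@continuous_powR_max _ p0 (hk_eta_max n j x)).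
by apply: cvgD; [exact: cvgMr H | exact: cl].
Qed.

Lemma hk_eta_at0 n j : (1 < n)%N -> hk_eta n j 0 = 0 :> R.
Proof.
move=> n1; have N1 : (1 : R) < n%:R by rewrite ltr1n.
have p0 : 0 < (n%:R - 1) / n%:R :> R by rewrite divr_gt0//; lra.
elim: j => [|j IH] /=; last rewrite IH.
all: by rewrite /hk_phi powR0 ?gt_eqF// mulr0 add0r mul0r.
Qed.

(** The left side D of the equation vanishes at 0 and exceeds 1 at some a1 <= 1, so it takes the
    value 1 strictly between 0 and a1. *)
Lemma hk_const_exists n : (1 < n)%N -> exists beta : R, 0 < beta < 1 /\
  (n%:R - 1) * (hk_eta n n beta - hk_eta n n.-1 beta) = 1.
Proof.
move=> n1; have N1 : (1 : R) < n%:R by rewrite ltr1n.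
pose D a := (n%:R - 1) * (hk_eta_max n n a - hk_eta_max n n.-1 a).
have cD : continuous D.
  move=> x; have c j := @continuous_hk_eta_max n j n1 x.
  rewrite /continuous_at /D.
  have H : hk_eta_max n n a - hk_eta_max n n.-1 a @[a --> x] -->
    hk_eta_max n n x - hk_eta_max n n.-1 x by apply: cvgB; exact: c.
  exact: cvgMr H.
have DE a : 0 <= a -> D a =
    n%:R * hk_eta n n.-1 a `^ ((n%:R - 1) / n%:R) + a
    - (n%:R - 1) * hk_eta n n.-1 a.
  move=> a0; rewrite /D !hk_eta_maxE// mulrBr; congr (_ - _).
  by have := hk_etaS n.-1 a n1; rewrite prednK ?(ltn_trans _ n1).
(* If w = eta_{n-1}(1) <= 1, take a1 = 1: a power below 1 does not decrease w, so D 1 >= w + 1.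
   Otherwise eta_{n-1} takes the value 1 at some a1, and there D a1 = 1 + a1. *)
have [a1 a1P Da1] : exists2 a1 : R, 0 < a1 <= 1 & 1 < D a1.
  have [e1|e1] := leP (hk_eta n n.-1 1) (1 : R).
    exists (1 : R); first by rewrite ltr01 lexx.
    have w0 : 0 < hk_eta n n.-1 (1 : R).
      case: (n.-1) => [|m] /=.
        have := hk_eta0 1 n1; rewrite /= => E.
        rewrite lt_neqAle hk_phi_ge0// andbT; apply/eqP => E'.
        by move: E; rewrite -E' mulr0; lra.
      rewrite /hk_phi ltr_wpDl ?mulr_ge0 ?powR_ge0 ?invr_ge0 ?divr_gt0//; lra.
    set w := hk_eta n n.-1 1 in e1 w0 *.
    have pw : w <= w `^ ((n%:R - 1) / n%:R).
      by apply: ger1_powR; rewrite ?w0// ler_pdivrMr; lra.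
    rewrite DE// -/w.
    have := ler_wpM2l (ler0n R n) pw; move: w0; lra.
  have [||a1 + Ea1] := @IVT R (hk_eta_max n n.-1) 0 1 1 ler01.
  - exact/continuous_subspaceT/continuous_hk_eta_max.
  - rewrite !hk_eta_maxE// hk_eta_at0//.
    by rewrite ge_min le_max ler01 (ltW e1) orbT.
  rewrite in_itv/= => /andP[a10 a11]; exists a1.
    rewrite a11 andbT lt_neqAle a10 andbT; apply/eqP => a1E.
    by move: Ea1; rewrite -a1E hk_eta_maxE// hk_eta_at0//; lra.
  have a1n0 : 0 != a1.
    by apply/eqP => a1E; move: Ea1; rewrite -a1E hk_eta_maxE// hk_eta_at0//; lra.
  have a1p : 0 < a1 by rewrite lt_neqAle a1n0.
  by rewrite DE// -hk_eta_maxE// Ea1 powR1; lra.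
have /andP[a10 a11] := a1P.
have D0 : D 0 = 0.
  have p0 : 0 < (n%:R - 1) / n%:R :> R by rewrite divr_gt0//; lra.
  by rewrite DE// hk_eta_at0// powR0 ?gt_eqF//; lra.
have [||b + Db] := @IVT R D 0 a1 1 (ltW a10).
- exact: continuous_subspaceT.
- by rewrite D0 ge_min le_max ler01 (ltW Da1) orbT.
rewrite in_itv/= => /andP[b0 b1].
exists b; split; last by move: Db; rewrite /D !hk_eta_maxE.
apply/andP; split.
  rewrite lt_neqAle b0 andbT; apply/eqP => E.
  by move: Db; rewrite -E D0 => /esym/eqP; rewrite oner_eq0.
rewrite (lt_le_trans _ a11)// lt_neqAle b1 andbT; apply/eqP => E.
by move: Da1; rewrite -E Db ltxx.
Qed.

Lemma hk_constP n : (1 < n)%N ->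
  let beta : R := hk_const R n in 0 < beta < 1 /\
  (n%:R - 1) * (hk_eta n n beta - hk_eta n n.-1 beta) = 1.
Proof. by move=> n1; exact: (xgetPex 0 (hk_const_exists n1)). Qed.

End hill_kertz_constants.

(** * Integrals of tail functions *)

Section primitive.
Context (R : realType).
Implicit Types (f g T : R -> R) (a b t : R).
Let mu := @lebesgue_measure R.

Lemma lebesgue_measure_oc a b : a <= b -> mu `]a, b] = (b - a)%:E.
Proof.
move=> ab; rewrite /mu lebesgue_measure_itv/= lte_fin; case: ltP => //= ba.
by have -> : b = a by [apply/le_anti; rewrite ab ba]; rewrite subrr.
Qed.

(** Values in [0, 1] make all integrals over bounded intervals finite, so that primitives can be
    real-valued. *)
Definition unit_mfun f := measurable_fun setT f /\ forall x, 0 <= f x <= 1.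

Definition primitive f v : R := (\int[mu]_(x in `[0%R, v]) f x)%R.

Lemma unit_mfun_cst (r : R) : 0 <= r <= 1 -> unit_mfun (cst r).
Proof. by move=> r01; split => //; exact: measurable_cst. Qed.

Lemma unit_mfun_nonincreasing f : nonincreasing_fun f ->
  (forall x, 0 <= f x <= 1) -> unit_mfun f.
Proof. by move=> fni f01; split => //; exact: nonincreasing_measurable. Qed.

Lemma unit_mfun_expR f t : 0 <= t -> unit_mfun f ->
  unit_mfun (fun x => expR (- t * f x)).
Proof.
move=> t0 [mf f01]; split=> [|x].
  by apply: measurableT_comp => //; exact: measurable_funM.
have /andP[f0 _] := f01 x.
by rewrite expR_ge0 -expR0 ler_expR mulNr oppr_le0 mulr_ge0.
Qed.

Lemma unit_mfun_integrable f (i : interval R) : unit_mfun f ->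
  (mu [set` i] < +oo)%E -> mu.-integrable [set` i] (EFin \o f).
Proof.
move=> [mf f01] i_fin; apply: measurable_bounded_integrable => //.
  exact: measurable_funTS.
exists 1; split=> // M M1 x _ /=; have /andP[f0 f1] := f01 x.
by rewrite ger0_norm// (le_trans f1)// ltW.
Qed.

Lemma primitive0 f : primitive f 0 = 0.
Proof. by rewrite /primitive set_itv1 Rintegral_set1. Qed.

Lemma primitiveB f a b : unit_mfun f -> 0 <= a -> a <= b ->
  primitive f b - primitive f a = (\int[mu]_(x in `]a, b]) f x)%R.
Proof.
move=> uf a0 ab; rewrite /primitive Rintegral_itvB ?bnd_simp//.
apply: unit_mfun_integrable => //.
by rewrite /mu lebesgue_measure_itv/=; case: ifP; rewrite ?ltry.
Qed.

(** No sign is imposed on c, p and q, so the same comparison covers constant bounds, tangent bounds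
    and complements such as 1 - f. *)
Lemma primitive_affine_le f g a b (c p q : R) : unit_mfun f -> unit_mfun g ->
  0 <= a -> a <= b -> (forall x, a < x -> x <= b -> c + p * f x <= q * g x) ->
  c * (b - a) + p * (primitive f b - primitive f a) <=
    q * (primitive g b - primitive g a).
Proof.
move=> uf ug a0 ab fg; rewrite !primitiveB//.
have fin : (mu `]a, b] < +oo)%E.
  by rewrite lebesgue_measure_oc// ltry.
have If := unit_mfun_integrable uf fin; have Ig := unit_mfun_integrable ug fin.
have IZ (r : R) h : mu.-integrable `]a, b] (EFin \o h) ->
    mu.-integrable `]a, b] (EFin \o (fun x => r * h x)).
  by move=> Ih; apply: (eq_integrable _ _ _ _ (integrableZl _ r Ih)).
have Ic : mu.-integrable `]a, b] (EFin \o cst c).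
  apply: measurable_bounded_integrable => //.
  by exists `|c|; split => // M cM x _ /=; exact: ltW.
have -> : c * (b - a) = (\int[mu]_(x in `]a, b]) cst c x)%R.
  rewrite Rintegral_cst//; congr (_ * _).
  exact/esym/(congr1 fine (lebesgue_measure_oc ab)).
have Ipf := IZ p _ If.
rewrite -!RintegralZl// -RintegralD//; apply: le_Rintegral => //.
- exact: (integrableD _ Ic Ipf).
- exact: IZ.
by move=> x /=; rewrite in_itv/= => /andP[ax xb]; exact: fg.
Qed.

Lemma primitive_cst (r a b : R) : 0 <= r <= 1 -> 0 <= a -> a <= b ->
  primitive (cst r) b - primitive (cst r) a = r * (b - a).
Proof.
move=> r01 a0 ab; have u0 := unit_mfun_cst r01.
rewrite primitiveB// Rintegral_cst//; congr (_ * _).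
exact: (congr1 fine (lebesgue_measure_oc ab)).
Qed.

Lemma eq_primitive f g a b : unit_mfun f -> unit_mfun g ->
  0 <= a -> a <= b -> (forall x, a < x -> x <= b -> f x = g x) ->
  primitive f b - primitive f a = primitive g b - primitive g a.
Proof.
move=> uf ug a0 ab fg; rewrite !primitiveB//; apply: eq_Rintegral => x.
by rewrite inE/= in_itv/= => /andP[ax xb]; exact: fg.
Qed.

Lemma primitive_le f a b : unit_mfun f -> 0 <= a -> a <= b ->
  0 <= primitive f b - primitive f a <= b - a.
Proof.
move=> uf a0 ab; have [_ f01] := uf.
have one : 0 <= (1 : R) <= 1 by rewrite ler01 lexx.
have u1 := unit_mfun_cst one; apply/andP; split.
  have := @primitive_affine_le f f a b 0 0 1 uf uf a0 ab.
  rewrite !mul0r !mul1r addr0; apply => x _ _; rewrite mul0r mul1r addr0.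
  by have /andP[] := f01 x.
have := @primitive_affine_le f (cst 1) a b 0 1 1 uf u1 a0 ab.
rewrite primitive_cst// mul0r add0r !mul1r; apply => x _ _.
by rewrite !mul1r add0r; have /andP[] := f01 x.
Qed.

(** For a tail f, the left side integrates the tail of the variable X cut to 0 outside X > a; the
    right side is a P(X > a) + E(X - a)^+. *)
Lemma primitive_comp_max f a : nonincreasing_fun f ->
  (forall x, 0 <= f x <= 1) -> 0 <= a <= 1 ->
  primitive (fun x => f (Num.max x a)) 1 = a * f a + (primitive f 1 - primitive f a).
Proof.
move=> fni f01 /andP[a0 a1]; have uf := unit_mfun_nonincreasing fni f01.
set g := fun x => _.
have um : unit_mfun g.
  apply: unit_mfun_nonincreasing => [x y xy|x]; last exact: f01.
  apply: fni.
  by rewrite ge_max !le_max xy lexx orbT.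
have E1 : primitive g a - primitive g 0 = a * f a.
  rewrite -[RHS](mulrC (f a)) -[X in _ * X]subr0 -primitive_cst//.
  apply: eq_primitive => //; first exact: unit_mfun_cst.
  by move=> x _ xa; rewrite /g max_r.
have E2 : primitive g 1 - primitive g a = primitive f 1 - primitive f a.
  by apply: eq_primitive => // x ax _; rewrite /g max_l// ltW.
by move: E1; rewrite primitive0; move: E2; lra.
Qed.

(** Since the bound is linear in T once q is replaced by 1 - h T, its integral involves T only
    through its primitive. *)
Lemma primitive_expR_tangent T t n a b (c : R) : unit_mfun T -> 0 <= t ->
  (0 < n)%N -> 0 <= c -> 0 <= a -> a <= b ->
  n%:R * c ^+ n.-1 * ((b - a) - t / n%:R * (primitive T b - primitive T a)) -
  (n%:R - 1) * c ^+ n * (b - a) <=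
  primitive (fun x => expR (- t * T x)) b - primitive (fun x => expR (- t * T x)) a.
Proof.
move=> uT t0 n0 c0 a0 ab; have [_ T01] := uT; set h := t / n%:R.
have n_neq0 : (n%:R : R) != 0 by rewrite pnatr_eq0 -lt0n.
have H := @primitive_affine_le T _ a b (n%:R * c ^+ n.-1 - (n%:R - 1) * c ^+ n)
  (- (n%:R * c ^+ n.-1 * h)) 1 uT (unit_mfun_expR t0 uT) a0 ab.
rewrite mul1r in H; apply: le_trans (H _).
  by rewrite le_eqVlt; apply/orP; left; apply/eqP; ring.
move=> x _ _; rewrite mul1r.
have -> : expR (- t * T x) = expR (- h * T x) ^+ n.
  by rewrite -expRM_natl; congr expR; rewrite /h; field.
case: n n0 @h {H} n_neq0 => // k _ h n_neq0.
apply: le_trans (exprn_ge_tangent k (expR_ge0 _) c0).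
have : 0 <= k.+1%:R * c ^+ k * (expR (- h * T x) - (1 - h * T x)).
  rewrite mulr_ge0 ?mulr_ge0 ?exprn_ge0// subr_ge0.
  by have := expR_ge1Dx (- h * T x); rewrite mulNr.
by rewrite -natr1 /=; lra.
Qed.

End primitive.

(** * Thresholds and values on a grid *)

Section threshold_values.
Context (R : realType) (T : R -> R).
Hypotheses (T_ni : nonincreasing_fun T) (T01 : forall x, 0 <= T x <= 1).
Implicit Types (h t theta : R) (l : seq R) (c : bitseq).

Let G := primitive T.
Let uT := unit_mfun_nonincreasing T_ni T01.

(* E(X - theta)^+ when T is the tail x |-> P(X > x) of a [0,1]-valued X. *)
Definition excess theta : R := primitive T 1 - primitive T theta.

Lemma excess_ge0 theta : 0 <= theta <= 1 -> 0 <= excess theta <= 1 - theta.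
Proof. by move=> /andP[h0 h1]; exact: primitive_le. Qed.

(** The dynamic programming step (1 - h) v + h E max(X, v), rewritten as v + h E(X - v)^+. *)
Fixpoint threshold_value h j : R :=
  if j is i.+1 then threshold_value h i + h * excess (threshold_value h i)
  else 0.

Lemma threshold_value_unit h j : 0 <= h <= 1 -> 0 <= threshold_value h j <= 1.
Proof.
move=> /andP[h0 h1]; elim: j => [|j /andP[v0 v1]] /=; first by rewrite lexx ler01.
have /andP[e0 e1] := @excess_ge0 (threshold_value h j) (introT andP (conj v0 v1)).
have := ler_pM h0 e0 h1 e1; have := mulr_ge0 h0 e0; rewrite mul1r; lra.
Qed.

Lemma threshold_value_nd h j : 0 <= h <= 1 ->
  threshold_value h j <= threshold_value h j.+1.
Proof.
move=> h01; rewrite /= lerDl mulr_ge0//; first by case/andP: h01.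
by case/andP: (excess_ge0 (threshold_value_unit j h01)).
Qed.

(** The condition t <= n gives h <= 1, which keeps all v_j in [0, 1]. *)
Lemma tail_certificate t n : (1 < n)%N -> 0 <= t <= n%:R ->
  1 - primitive (fun x => expR (- t * T x)) 1 <=
  threshold_value (t / n%:R) n + hk_const R n.
Proof.
move=> n1 /andP[t0 tn]; have n0 : (0 < n)%N by exact: ltn_trans n1.
have N0 : (0 : R) < n%:R by rewrite ltr0n.
have h01 : 0 <= t / n%:R <= 1.
  by rewrite divr_ge0 ?ler0n//= ler_pdivrMr// mul1r.
have [/andP[b0 _] bE] := hk_constP R n1.
apply: (@dual_certificate_bound R n (t / n%:R) (hk_const R n)
  (primitive (fun x => expR (- t * T x))) G (threshold_value (t / n%:R))
  n1 (ltW b0) bE) => //.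
- by move=> c a b c0 a0 ab _; exact: primitive_expR_tangent.
- exact: primitive0.
- by move=> j; case/andP: (threshold_value_unit j h01).
- by move=> j; case/andP: (threshold_value_unit j h01).
- by move=> j; exact: threshold_value_nd.
Qed.

(* The expected reward from stopping at the first of X_1, X_2, ... exceeding
   its threshold, there being one X per threshold. *)
Fixpoint run_value l : R :=
  if l is theta :: l' then
    theta * T theta + excess theta + (1 - T theta) * run_value l'
  else 0.

(** A mask marks the cells with exactly one arrival, the others being empty; [mask c l] then lists
    the thresholds met by X_1, X_2, ... in turn. An explicit list splits along its first bit, which
    is the recursion over the cells. *)
Fixpoint masks n : seq bitseq :=
  if n is m.+1 then map (cons false) (masks m) ++ map (cons true) (masks m)
  else [:: [::]].

Lemma mem_masks n c : (c \in masks n) = (size c == n).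
Proof.
elim: n c => [|n IH] c; first by rewrite mem_seq1 size_eq0.
rewrite /= mem_cat; case: c => [|b c].
  by apply/norP; split; apply/mapP => -[].
rewrite eqSS -IH; apply/orP/idP => [|cn].
  by case=> /mapP[c' + [_ ->]].
by case: b; [right|left]; apply/mapP; exists c.
Qed.

Lemma uniq_masks n : uniq (masks n).
Proof.
elim: n => [//|n IH] /=; rewrite cat_uniq !map_inj_uniq ?IH ?andbT//=.
- by apply/hasPn => _ /mapP[c _ ->]; apply/mapP => -[].
- by move=> c c' [].
- by move=> c c' [].
Qed.

(* The Poisson weights of the interval counts 0 and 1. *)
Definition mask_weight h c : R :=
  \prod_(b <- c) (expR (- h) * (if b then h else 1)).

Definition masked_value h l : R :=
  \sum_(c <- masks (size l)) mask_weight h c * run_value (mask c l).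

(** This is the probability that no cell has two arrivals. *)
Lemma sum_mask_weight h n :
  \sum_(c <- masks n) mask_weight h c = (expR (- h) * (1 + h)) ^+ n.
Proof.
elim: n => [|n IH] /=; first by rewrite big_seq1 /mask_weight big_nil.
rewrite big_cat !big_map /=.
under eq_bigr do rewrite /mask_weight big_cons -/(mask_weight h _).
rewrite -mulr_sumr IH.
under eq_bigr do rewrite /mask_weight big_cons -/(mask_weight h _).
by rewrite -mulr_sumr IH exprS; ring.
Qed.

(** Distinguishes whether the first cell is empty or has one arrival. A reward already taken still
    carries the total weight of the later masks, because outcomes with a later double arrival are
    discarded even after stopping. *)
Lemma masked_value_cons h theta l : masked_value h (theta :: l) =
  expR (- h) * masked_value h l + h * expR (- h) *
    ((theta * T theta + excess theta) * (expR (- h) * (1 + h)) ^+ size l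
     + (1 - T theta) * masked_value h l).
Proof.
rewrite -sum_mask_weight /masked_value /= big_cat !big_map /=; congr (_ + _).
  rewrite mulr_sumr; apply: eq_bigr => c _.
  by rewrite /mask_weight big_cons; ring.
rewrite mulr_sumr mulr_sumr -big_split/= mulr_sumr; apply: eq_bigr => c _.
by rewrite /mask_weight big_cons; ring.
Qed.

(** Listed in order of time: the first cell gets v_{n-1}, the value of the n - 1 cells that remain
    after it, and the last gets v_0 = 0. *)
Fixpoint thresholds h n : seq R :=
  if n is m.+1 then threshold_value h m :: thresholds h m else [::].

Lemma size_thresholds h n : size (thresholds h n) = n.
Proof. by elim: n => //= n ->. Qed.

Lemma thresholds_unit h n : 0 <= h <= 1 ->
  all (fun theta => 0 <= theta <= 1) (thresholds h n).
Proof. by move=> h01; elim: n => //= n ->; rewrite threshold_value_unit. Qed.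

Lemma expRN_weight h : 0 <= h -> 1 - h ^+ 2 <= expR (- h) * (1 + h) <= 1.
Proof.
move=> h0; apply/andP; split.
  have := ler_wpM2r (addr_ge0 ler01 h0) (expR_ge1Dx (- h)); lra.
by rewrite expRN mulrC ler_pdivrMr ?expR_gt0// mul1r expR_ge1Dx.
Qed.

Lemma exprn_weight_ge h n : 0 <= h ->
  1 - n%:R * h ^+ 2 <= (expR (- h) * (1 + h)) ^+ n.
Proof.
move=> h0; have /andP[w0 w1] := expRN_weight h0; set w := expR _ * _ in w0 w1 *.
have wp : 0 <= w by rewrite mulr_ge0 ?expR_ge0// addr_ge0.
elim: n => [|n IH]; first by rewrite expr0; lra.
have H1 := ler_wpM2l (exprn_ge0 n wp) w0.
have H2 := ler_wpM2r (sqr_ge0 h) (exprn_ile1 n wp w1).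
rewrite (exprSr w) -(natr1 n); set x := w ^+ n in IH H1 H2 *.
move: IH H1 H2; lra.
Qed.

(** With threshold v, the term v T(v) from stopping and v (1 - T(v)) from continuing add up to v, so
    one cell turns v into v + h e up to errors. The bounds exp (- h) (1 + h) >= 1 - h^2 and exp (-
    h) >= 1 - h lose at most 2 h^2; discarding later double arrivals loses at most h n h^2 <= t
    h^2. *)
Lemma masked_value_ge h t n : 0 <= h <= 1 -> n%:R * h <= t ->
  threshold_value h n - n%:R * (2 + t) * h ^+ 2 <=
  masked_value h (thresholds h n).
Proof.
move=> h01; have /andP[h0 h1] := h01; elim: n => [|n IH] nt.
  by rewrite /masked_value big_seq1 /=; lra.
have nt' : n%:R * h <= t.
  by apply: le_trans nt; rewrite ler_wpM2r// ler_nat.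
have {IH} := IH nt'; rewrite [thresholds _ _]/= masked_value_cons size_thresholds.
set v := threshold_value h n; set W := masked_value _ _ => IH.
have v01 : 0 <= v <= 1 := threshold_value_unit n h01.
have /andP[v0 v1] := v01.
have /andP[e0 e1] := excess_ge0 v01; have /andP[T0 T1] := T01 v.
have := exprn_weight_ge n h0; set q := _ ^+ n => qge.
have /andP[w0 w1] := expRN_weight h0.
rewrite [threshold_value h n.+1]/= -/v.
set e := excess v in e0 e1 *; set D := n%:R * (2 + t) * h ^+ 2 in IH *.
have -> : n.+1%:R * (2 + t) * h ^+ 2 = D + (2 + t) * h ^+ 2.
  by rewrite /D -natr1; ring.
have z_ge : 1 - h <= expR (- h) by exact: expR_ge1Dx.
have z0 : 0 <= expR (- h) by exact: expR_ge0.
have z1 : expR (- h) <= 1 by rewrite -expR0 ler_expR oppr_le0.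
set z := expR (- h) in z_ge z0 z1 w0 w1 *.
have t0 : 0 <= t by apply: le_trans nt'; rewrite mulr_ge0.
have D0 : 0 <= D by rewrite /D !mulr_ge0// addr_ge0.
have T1' : 0 <= 1 - T v by rewrite subr_ge0.
have zT0 : 0 <= z * (1 + h * (1 - T v)) by rewrite mulr_ge0// addr_ge0// mulr_ge0.
have zT1 : z * (1 + h * (1 - T v)) <= 1.
  by have := mulr_ge0 z0 (mulr_ge0 h0 T0); move: w1; lra.
have gain0 : 0 <= v * T v + e by rewrite addr_ge0// mulr_ge0.
have gain1 : v * T v + e <= 1 by have := mulr_ge0 v0 T1'; lra.
have zgain1 : z * (v * T v + e) <= 1 by have := ler_pM z0 gain0 z1 gain1; lra.
have hq : h - t * h ^+ 2 <= h * q.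
  have := ler_wpM2l h0 qge; have := ler_wpM2r (sqr_ge0 h) nt'; lra.
have H1 := ler_wpM2l zT0 IH.
have H2 := ler_wpM2l (mulr_ge0 z0 gain0) hq.
have H3 := ler_wpM2r v0 w0.
have H4 := ler_wpM2r (mulr_ge0 h0 e0) z_ge.
have H5 := ler_wpM2r D0 zT1.
have H6 := ler_wpM2r (mulr_ge0 t0 (sqr_ge0 h)) zgain1.
have H7 : h ^+ 2 * v <= h ^+ 2 by rewrite ler_piMr ?sqr_ge0//.
have H8 : h ^+ 2 * e <= h ^+ 2 by rewrite ler_piMr ?sqr_ge0//; lra.
move: H1 H2 H3 H4 H5 H6 H7 H8; lra.
Qed.

End threshold_values.

(** * Arrivals *)

Lemma card_II_inj (T : Type) (A : set T) c c' :
  (A #= `I_c)%card -> (A #= `I_c')%card -> c = c'.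
Proof.
move=> Ac Ac'; have : (`I_c #= `I_c')%card.
  by apply: card_eq_trans Ac'; rewrite card_eq_sym.
by rewrite card_eq_le !card_le_II -eqn_leq => /eqP.
Qed.

Lemma card_shift_II m c : ((addn m.+1) @` `I_c #= `I_c)%card.
Proof. by apply: inj_card_eq => i j _ _ /addnI. Qed.

Section arrival_counts.
Context (R : realType) (s : nat -> R).
Hypothesis s_lt : forall k, s k < s k.+1.
Implicit Types (a b : R) (c m k : nat).

Let s_mono i j : (s i <= s j) = (i <= j)%N.
Proof. exact: Order.NatMonotonyTheory.incnP. Qed.

Let s_lt_mono i j : (s i < s j) = (i < j)%N.
Proof. by rewrite ltNge s_mono -ltnNge. Qed.

Lemma arrivals_card m c a b : s m <= a < s m.+1 ->
  s (m + c)%N <= b < s (m + c).+1 -> ([set k | a < s k <= b] #= `I_c)%card.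
Proof.
move=> /andP[ma am] /andP[cb bc].
rewrite (_ : [set k | _] = (addn m.+1) @` `I_c); first exact: card_shift_II.
apply/seteqP; split => [k /= /andP[ak kb]|_ [i /= ic <-]].
  have mk : (m < k)%N by rewrite -s_lt_mono (le_lt_trans ma).
  have kc : (k < (m + c).+1)%N by rewrite -s_lt_mono (le_lt_trans kb).
  exists (k - m.+1)%N; last by rewrite subnKC.
  by rewrite /= ltn_subLR// addSn.
rewrite (lt_le_trans am) ?s_mono ?leq_addr//=.
by rewrite (le_trans _ cb)// s_mono addSn -addnS leq_add2l.
Qed.

(** Converse of [arrivals_card]: a finite count on ]a, b] forces some arrival after b, and the first
    such arrival determines the count. *)
Lemma arrivals_next m c a b : s m <= a < s m.+1 -> a <= b ->
  ([set k | a < s k <= b] #= `I_c)%card -> s (m + c)%N <= b < s (m + c).+1.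
Proof.
move=> mam ab cardc; have /andP[ma am] := mam.
(* If no arrival exceeded b, the c + 1 arrivals following m would all lie in ]a, b]. *)
have [[k bk]|nk] := pselect (exists k, b < s k); last first.
  have sb k : s k <= b by rewrite leNgt; apply/negP => bk; apply: nk; exists k.
  have : (`I_c.+1 #<= `I_c)%card.
    rewrite -(card_le_eqr cardc) -(card_le_eql (card_shift_II m c.+1)).
    apply: subset_card_le => _ [i _ <-] /=.
    by rewrite sb (lt_le_trans am)// s_mono leq_addr.
  by rewrite card_le_II ltnn.
have [j bj jmin] := ex_minnP (ex_intro (fun k => b < s k) k bk).
have mj : (m < j)%N by rewrite -s_lt_mono (le_lt_trans ma)// (le_lt_trans ab).
have jb : s j.-1 <= b < s j.-1.+1.
  rewrite prednK ?(leq_ltn_trans _ mj)// bj andbT leNgt; apply/negP => /jmin.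
  by rewrite leqNgt prednK ?leqnn// (leq_ltn_trans _ mj).
have jE : j.-1 = (m + (j.-1 - m))%N.
  by rewrite subnKC// -ltnS prednK// (leq_ltn_trans _ mj).
rewrite jE in jb; have := arrivals_card mam jb.
by move=> /(card_II_inj cardc) ->.
Qed.

Lemma arrivals_card0 a b c : (forall k, s k <= a) ->
  ([set k | a < s k <= b] #= `I_c)%card <-> c = 0%N.
Proof.
move=> sa; have -> : [set k | a < s k <= b] = set0.
  by apply/seteqP; split => // k /= /andP[ak _]; move: (sa k); rewrite leNgt ak.
split=> [|->]; last by rewrite II0 card_eqxx.
by rewrite card_eq_sym card_eq0 => /eqP; case: c => // c /seteqP[/(_ 0%N)] /(_ isT).
Qed.

(** The second alternative is explosion no later than a. *)
Lemma exists_last_arrival a : s 0%N <= a ->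
  (exists m, s m <= a < s m.+1) \/ (forall k, s k <= a).
Proof.
move=> s0a; have [|na] := pselect (forall k, s k <= a); [by right|left].
have [k ak] : exists k, a < s k.
  by move/existsNP : na => [k /negP]; rewrite -ltNge; exists k.
have [j aj jmin] := ex_minnP (ex_intro (fun k => a < s k) k ak).
have j0 : (0 < j)%N by rewrite -s_lt_mono (le_lt_trans s0a).
exists j.-1; rewrite prednK// aj andbT leNgt; apply/negP => /jmin.
by rewrite leqNgt prednK// leqnn.
Qed.

End arrival_counts.

Section sigma_algebra_of_arrivals.
Context (R : realType) (d : measure_display) (T : measurableType d).
Variable (S : nat -> T -> R).
Hypotheses (S0 : forall w, S 0%N w = 0) (S_lt : forall k w, S k w < S k.+1 w).

Let G : set (set T) :=
  \bigcup_k preimage_set_system setT (S k.+1) measurable.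
Let TG := g_sigma_algebraType G.

Lemma g_sigma_seq_le k (a : R) : measurable ([set w | S k w <= a] : set TG).
Proof.
case: k => [|k].
  rewrite (_ : [set w | _] = if 0 <= a then setT else set0); first by case: ifP.
  apply/seteqP; split => w /=; rewrite S0; first by move=> ->.
  by case: ifP.
apply: sub_sigma_algebra; exists k => //; exists `]-oo, a]%classic => //.
by rewrite setTI; apply/seteqP; split => w /=; rewrite in_itv.
Qed.

Lemma g_sigma_seq_lt k (a : R) : measurable ([set w | a < S k w] : set TG).
Proof.
rewrite (_ : [set w | _] = ~` [set w | S k w <= a]).
  by apply: measurableC; exact: g_sigma_seq_le.
by apply/seteqP; split => w /=; rewrite ltNge => /negP.
Qed.

(** Needed because the independence of arrivals and values is stated for the sigma-algebra of S_1,
    S_2, .... The event is split by the index m of the last arrival up to a; after an explosion the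
    count is 0. *)
Lemma g_sigma_seq_has_arrivals (a b : R) c : 0 <= a -> a <= b ->
  g_sigma_seq (fun k => S k.+1) (has_arrivals S a b c).
Proof.
move=> a0 ab.
pose E m x : set T := [set w | S m w <= x] `&` [set w | x < S m.+1 w].
have mE m x : measurable (E m x : set TG).
  by apply: measurableI; [exact: g_sigma_seq_le|exact: g_sigma_seq_lt].
suff -> : has_arrivals S a b c =
    (\bigcup_m (E m a `&` E (m + c)%N b)) `|`
    (if c == 0%N then \bigcap_m [set w | S m w <= a] else set0).
  apply: (@measurableU _ TG).
    by apply: bigcup_measurable => m _; exact: measurableI.
  by case: ifP => // _; apply: bigcap_measurable => // m _; exact: g_sigma_seq_le.
apply/seteqP; split => w.
  move=> cardc.
  have [|[m mam]|all_le] := @exists_last_arrival _ (S ^~ w) (S_lt ^~ w) a.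
  - by rewrite S0.
  - left; exists m => //; have /andP[? ?] := mam; split; first by split.
    by have /andP[? ?] := arrivals_next (S_lt ^~ w) mam ab cardc; split.
  - by right; have -> := (arrivals_card0 b c all_le).1 cardc; rewrite eqxx => m _ /=.
case=> [[m _ [[? ?] [? ?]]]|].
  by apply: (@arrivals_card _ (S ^~ w) (S_lt ^~ w) m); apply/andP.
case: eqP => // -> all_le; apply: (arrivals_card0 b 0 _).2 => // k.
exact: all_le.
Qed.

End sigma_algebra_of_arrivals.

(** * The prophet *)

Section unit_random_variables.
Context (R : realType) (d : measure_display) (Omega : measurableType d).
Variable P : probability Omega R.
Implicit Types (Y : Omega -> R) (x : R).

Definition tail Y x : R := fine (P [set w | x < Y w]).

Lemma measurable_gt Y x : measurable_fun setT Y -> measurable [set w | x < Y w].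
Proof.
move=> mY; have := mY measurableT `]x, +oo[%classic (measurable_itv _).
rewrite setTI; congr measurable.
by apply/seteqP; split => w /=; rewrite in_itv/= andbT.
Qed.

Lemma tailK Y x : measurable_fun setT Y ->
  (tail Y x)%:E = P [set w | x < Y w].
Proof. by move=> mY; rewrite fineK// fin_num_measure//; exact: measurable_gt. Qed.

Lemma tail_unit Y x : measurable_fun setT Y -> 0 <= tail Y x <= 1.
Proof.
move=> mY; rewrite -!lee_fin tailK// measure_ge0/= probability_le1//.
exact: measurable_gt.
Qed.

Lemma tail_nonincreasing Y : measurable_fun setT Y -> nonincreasing_fun (tail Y).
Proof.
move=> mY x y xy; rewrite -lee_fin !tailK//.
apply: le_measure; rewrite ?inE; [exact: measurable_gt..|].
by move=> w /=; exact: le_lt_trans.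
Qed.

Lemma tail_unit_mfun Y : measurable_fun setT Y -> unit_mfun (tail Y).
Proof.
move=> mY; apply: unit_mfun_nonincreasing; first exact: tail_nonincreasing.
by move=> x; exact: tail_unit.
Qed.

Lemma integral_unit Y : measurable_fun setT Y -> (forall w, 0 <= Y w <= 1) ->
  (\int[P]_w (Y w)%:E)%E = (primitive (tail Y) 1)%:E.
Proof.
move=> mY Y01.
pose Y' : {RV P >-> R} := HB.pack Y (@isMeasurableFun.Build _ _ _ _ Y mY).
have Y'0 w : 0 <= Y' w by case/andP: (Y01 w).
have := ge0_expectation_ccdf Y'0; rewrite expectation_def => ->.
have ccdfE x : ccdf Y' x = (tail Y x)%:E.
  rewrite tailK// /ccdf /distribution /pushforward; congr (P _).
  by apply/seteqP; split => w /=; rewrite in_itv/= andbT.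
have itvE : `[0%R, +oo[%classic = `[0%R, 1%R] `|` `]1%R, +oo[ :> set R.
  by rewrite -itv_bndbnd_setU// bnd_simp.
rewrite itvE ge0_integral_setU//=; last 2 first.
- by apply: measurable_funTS; exact: ccdf_measurable.
- rewrite disj_set2E; apply/eqP/seteqP; split => // x /=.
  by rewrite !in_itv/= andbT => -[/andP[_ x1]]; rewrite ltNge x1.
rewrite [X in (_ + X)%E](_ : _ = 0%E); last first.
  apply: integral0_eq => x /=; rewrite in_itv/= andbT => x1.
  rewrite ccdfE tailK// (_ : [set w | _] = set0) ?measure0//.
  apply/seteqP; split => // w /= xY; have /andP[_ Y1] := Y01 w.
  by have := lt_trans x1 xY; rewrite ltNge Y1.
rewrite adde0 /primitive /Rintegral fineK.
  by apply: eq_integral => x _; rewrite ccdfE.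
apply: integrable_fin_num => //; apply: unit_mfun_integrable.
  exact: tail_unit_mfun.
by rewrite lebesgue_measure_itv/=; case: ifP; rewrite ?ltry.
Qed.

Lemma measurable_fun_select (N : Omega -> nat) (f : nat -> Omega -> R) :
  (forall k, measurable (N @^-1` [set k])) ->
  (forall k, measurable_fun setT (f k)) ->
  measurable_fun setT (fun w => f (N w) w).
Proof.
move=> mN mf _ B mB; rewrite setTI.
rewrite (_ : _ @^-1` B = \bigcup_k (N @^-1` [set k] `&` f k @^-1` B)).
  apply: bigcup_measurable => k _; apply: measurableI => //.
  by rewrite -[_ @^-1` _]setTI; exact: mf.
by apply/seteqP; split => [w Bw|w [k _ [/= <-]]//]; exists (N w).
Qed.

End unit_random_variables.

(** Shows that the event that the search returns k depends only on p 0, ..., p k. The value k = N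
    means that the search fails, hence the implication. *)
Lemma find_iotaP (p : pred nat) N k : (find p (iota 0 N) = k) <->
  [/\ (k <= N)%N, (k < N)%N -> p k & forall j, (j < k)%N -> ~~ p j].
Proof.
split=> [<-|[kN pk nop]].
  split=> [|lt_f|j lt_j]; first by rewrite -[leqRHS](size_iota 0) find_size.
    have := nth_find 0%N (a := p) (s := iota 0 N).
    by rewrite has_find size_iota lt_f nth_iota// add0n; exact.
  have jN : (j < N)%N.
    by rewrite (leq_trans lt_j)// -[leqRHS](size_iota 0) find_size.
  by have := before_find 0%N lt_j; rewrite nth_iota// add0n => ->.
rewrite -(subnKC kN) iotaD find_cat add0n size_iota ifF; last first.
  by apply/negbTE/hasPn => j; rewrite mem_iota => /andP[_]; exact: nop.
move: kN; rewrite leq_eqVlt => /predU1P[->|kN]; first by rewrite subnn addn0.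
by rewrite -subnSK//= pk// addn0.
Qed.

Section model.
Context (R : realType) (d : measure_display) (Omega : measurableType d).
Context (P : probability Omega R) (X : {RV P >-> R}) (Xs S : nat -> {RV P >-> R}).
Hypothesis Xs01 : forall k w, 0 <= Xs k.+1 w <= 1.
Hypothesis Xs_law : forall k (B : set R), measurable B ->
  P (Xs k.+1 @^-1` B) = P (X @^-1` B).
Hypothesis Xs_indep : mutually_independent P (fun k => Xs k.+1 : Omega -> R).
Hypothesis S_poisson : poisson_arrivals P 1 (fun k => S k : Omega -> R).
Hypothesis SX_indep : independent_seqs P (fun k => S k.+1 : Omega -> R)
  (fun k => Xs k.+1 : Omega -> R).

Let T := tail P X.
Let S0 w : S 0%N w = 0. Proof. by have [] := S_poisson. Qed.
Let S_lt k w : S k w < S k.+1 w. Proof. by have [_ + _] := S_poisson. Qed.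

Lemma g_sigma_seq_measurable (Y : nat -> {RV P >-> R}) A :
  g_sigma_seq (fun k => Y k.+1 : Omega -> R) A -> measurable A.
Proof.
apply: smallest_sub; first exact: sigma_algebra_measurable.
by move=> _ [k _ [B mB <-]]; exact: measurable_funPT.
Qed.

Definition future m j (C : nat -> set R) : set Omega :=
  \bigcap_(i in `I_j) (Xs (m + i).+1 @^-1` C i).

Lemma measurable_future m j C : (forall i, measurable (C i)) ->
  measurable (future m j C).
Proof.
move=> mC; apply: bigcap_measurableType => i _.
by rewrite -[_ @^-1` _]setTI; exact: measurable_funPT.
Qed.

(** D may depend on all arrival times and on X_1, ..., X_m. The product formula against cylinders of
    later values replaces conditioning on D. *)
Definition independent_of_future m (D : set Omega) := measurable D /\
  forall j C, (forall i, measurable (C i)) ->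
    P (D `&` future m j C) = (P D * \prod_(i < j) P (X @^-1` C i))%E.

Lemma arrivals_independent_of_future A :
  g_sigma_seq (fun k => S k.+1 : Omega -> R) A -> independent_of_future 0 A.
Proof.
move=> sA; split; first exact: g_sigma_seq_measurable sA.
move=> j C mC; rewrite SX_indep//.
  congr (_ * _)%E; have := Xs_indep (iota_uniq 0 j) mC.
  have iotaE : [set` iota 0 j] = `I_j.
    by apply/seteqP; split => i /=; rewrite mem_iota add0n.
  rewrite iotaE -[LHS]/(P (future 0 j C)) => ->.
  rewrite -{1}(subn0 j) -/(index_iota 0 j) big_mkord.
  by apply: eq_bigr => i _; exact: Xs_law.
apply: (@bigcap_measurableType _ (g_sigma_algebraType _)) => i _.
apply: sub_sigma_algebra; exists i => //; exists (C i) => //.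
by rewrite setTI.
Qed.

Lemma independent_of_future_next m D (C : set R) : measurable C ->
  independent_of_future m D ->
  P (D `&` Xs m.+1 @^-1` C) = (P D * P (X @^-1` C))%E /\
  independent_of_future m.+1 (D `&` Xs m.+1 @^-1` C).
Proof.
move=> mC [mD indD].
(* Prepending C to the cylinder C' makes it a cylinder starting one index earlier, to which the
   hypothesis on D applies. *)
have futS j C' : future m j.+1 (fun i => if i is i'.+1 then C' i' else C) =
    Xs m.+1 @^-1` C `&` future m.+1 j C'.
  apply/seteqP; split => w.
    move=> fw; split; first by have := fw 0%N isT; rewrite addn0.
    by move=> i ij; have := fw i.+1 ij; rewrite addnS.
  move=> [w0 fw] [_|i ij]; first by rewrite addn0.
  by rewrite addnS; exact: fw.
have DC : P (D `&` Xs m.+1 @^-1` C) = (P D * P (X @^-1` C))%E.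
  have := indD 1%N (fun=> C) (fun=> mC); rewrite big_ord1 => <-.
  congr (P (_ `&` _)); apply/seteqP; split => [w Cw [|//] _|w /(_ 0%N isT)].
    by rewrite addn0.
  by rewrite addn0.
split=> //; split.
  by apply: measurableI => //; rewrite -[_ @^-1` _]setTI; exact: measurable_funPT.
move=> j C' mC'; rewrite -setIA -futS indD; last by case.
by rewrite big_ord_recl DC muleA.
Qed.

Lemma has_arrivals0_count t c w : 0 <= t ->
  has_arrivals (fun k => S k : Omega -> R) 0 t c w ->
  arrival_count (fun k => S k : Omega -> R) t w = c.
Proof.
move=> t0 cardc.
have S01 : S 0%N w <= 0 < S 1%N w by rewrite S0 lexx /= -(S0 w) S_lt.
have := arrivals_next (S_lt ^~ w) S01 t0 cardc; rewrite add0n => /andP[ct tc].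
have le_c j : S j w <= t -> (j <= c)%N.
  move=> jt; rewrite -ltnS ltnNge; apply/negP => cj.
  have Scj : S c.+1 w <= S j w.
    by rewrite (Order.NatMonotonyTheory.incnP (S_lt ^~ w)).
  by have := lt_le_trans tc (le_trans Scj jt); rewrite ltxx.
apply: xget_unique => [//|k [kt kmax]].
by apply/eqP; rewrite eqn_leq le_c// kmax.
Qed.

Lemma cdf_tail x : P (X @^-1` `]-oo, x]) = (1 - T x)%:E.
Proof.
have mX : measurable_fun setT X by exact: measurable_funPT.
rewrite EFinB tailK// -probability_setC; last exact: measurable_gt.
congr (P _); apply/seteqP; split => w /=; rewrite in_itv/= leNgt; first by move/negP.
by move/negP.
Qed.

Lemma prob_arrivals_grid n (h : R) (c : nat -> nat) : 0 < h ->
  P (\bigcap_(j in `I_n)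
      has_arrivals (fun k => S k : Omega -> R) (j%:R * h) (j.+1%:R * h) (c j)) =
  (\prod_(j < n) poisson_pmf h (c j))%:E.
Proof.
move=> h0; have [_ _ poisson] := S_poisson.
rewrite (poisson n (fun j => j%:R * h) c) ?mul0r//.
  by congr EFin; apply: eq_bigr => j _; congr poisson_pmf; rewrite -natr1; ring.
by move=> j; rewrite ltr_pM2r// ltr_nat.
Qed.

Lemma prob_has_arrivals0 t c : 0 < t ->
  P (has_arrivals (fun k => S k : Omega -> R) 0 t c) = (poisson_pmf t c)%:E.
Proof.
move=> t0; have := prob_arrivals_grid 1 (fun=> c) t0; rewrite big_ord1 => <-.
congr (P _); apply/seteqP; split => [w cw [|//] _|w /(_ 0%N isT)].
  by rewrite mul0r mul1r.
by rewrite mul0r mul1r.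
Qed.

Lemma measurable_arrival_count t k :
  measurable (arrival_count (fun k => S k : Omega -> R) t @^-1` [set k]).
Proof.
have mS j : measurable [set w | S j w <= t].
  rewrite (_ : [set w | _] = ~` [set w | t < S j w]).
    by apply: measurableC; apply: measurable_gt; exact: measurable_funPT.
  by apply/seteqP; split => w /=; rewrite leNgt => /negP.
pose last j : set Omega :=
  [set w | S j w <= t] `&` \bigcap_(i in [set i | (j < i)%N]) ~` [set w | S i w <= t].
have mlast j : measurable (last j).
  apply: measurableI => //; apply: bigcap_measurableType => i _.
  exact: measurableC.
have lastP j w : last j w <-> (S j w <= t /\ forall i, S i w <= t -> (i <= j)%N).
  split=> -[jt jmax]; split=> // i; last by move=> ji /jmax; rewrite leqNgt ji.
  by move=> it; rewrite leqNgt; apply/negP => ji; exact: jmax ji it.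
have last_uniq i j w : last i w -> last j w -> i = j.
  move=> /lastP[it imax] /lastP[jt jmax].
  by apply/eqP; rewrite eqn_leq jmax// imax.
(* Outcomes without a last arrival fall under k = 0, the default of [xget]. *)
rewrite (_ : _ @^-1` _ = last k `|` (if k == 0%N then ~` \bigcup_j last j else set0)).
  apply: measurableU => //; case: ifP => // _.
  by apply: measurableC; exact: bigcup_measurable.
apply/seteqP; split => w /=; rewrite /arrival_count; case: xgetP.
- by move=> j _ /lastP jw <-; left.
- move=> none <-; right; rewrite eqxx => -[j _ /lastP]; exact: none.
- move=> j _ /lastP jw [kw|]; first exact: last_uniq jw kw.
  by case: eqP => // _ []; exists j.
- by move=> none [/lastP/none//|]; case: eqP.
Qed.

Definition prophet_max t w : R :=
  \big[Num.max/0]_(k < arrival_count (fun k => S k : Omega -> R) t w) Xs k.+1 w.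

Lemma measurable_prophet_max t : measurable_fun setT (prophet_max t).
Proof.
apply: (@measurable_fun_select _ _ _ _ (fun n w => \big[Num.max/0]_(k < n) Xs k.+1 w)).
  exact: measurable_arrival_count.
have mX k : measurable_fun setT (Xs k.+1) by exact: measurable_funPT.
suff max_mfun n (f : nat -> Omega -> R) :
    (forall k, measurable_fun setT (f k)) ->
    measurable_fun setT (fun w => \big[Num.max/0]_(k < n) f k w).
  by move=> n; exact: (max_mfun n (fun k => Xs k.+1)).
elim: n f => [|n IH] f mf.
  by under eq_fun do rewrite big_ord0; exact: measurable_cst.
under eq_fun do rewrite big_ord_recl /=.
by apply: measurable_maxr => //; exact: (IH (fun k => f k.+1)).
Qed.

Lemma prophet_max_unit t w : 0 <= prophet_max t w <= 1.
Proof.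
rewrite bigmax_ge_id/=; apply: bigmax_le => // i _.
by case/andP: (Xs01 i w).
Qed.

(** Given c arrivals, all values are at most x with probability (1 - T x)^c; summed with Poisson
    weights this is the exponential series. Partial sums over the disjoint events [D c] suffice, as
    only a lower bound on P(max <= x) is wanted. Nonnegative x covers the empty maximum. *)
Lemma prophet_max_tail t x : 0 < t -> 0 <= x ->
  expR (- t * T x) <= 1 - tail P (prophet_max t) x.
Proof.
move=> t0 x0; set q := 1 - T x.
have mX : measurable_fun setT X by exact: measurable_funPT.
pose D c := has_arrivals (fun k => S k : Omega -> R) 0 t c `&`
  future 0 c (fun=> `]-oo, x]%classic).
have arrD c : g_sigma_seq (fun k => S k.+1 : Omega -> R)
    (has_arrivals (fun k => S k : Omega -> R) 0 t c).
  by apply: (g_sigma_seq_has_arrivals S0 S_lt) => //; exact: ltW.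
have mD c : measurable (D c).
  apply: measurableI; last exact: measurable_future.
  exact: g_sigma_seq_measurable (arrD c).
have PD c : P (D c) = (expR (- t) * exp_coeff (t * q) c)%:E.
  have [_ ->//] := arrivals_independent_of_future (arrD c).
  rewrite prob_has_arrivals0// (eq_bigr (fun=> q%:E)); last first.
    by move=> i _; exact: cdf_tail.
  rewrite prodEFin -EFinM prodr_const card_ord /poisson_pmf t0 /exp_coeff/=.
  by rewrite exprMn; congr EFin; ring.
have trivD : trivIset setT D.
  by move=> i j _ _ [w [[iw _] [jw _]]]; exact: card_II_inj iw jw.
have partial n : expR (- t) * series (exp_coeff (t * q)) n <=
    1 - tail P (prophet_max t) x.
  have mY := measurable_prophet_max t.
  rewrite -lee_fin EFinB tailK// -probability_setC; last exact: measurable_gt.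
  rewrite /series/= big_mkord mulr_sumr -sumEFin.
  under eq_bigr do rewrite -PD.
  rewrite -measure_bigsetU//; apply: le_measure.
  - by rewrite inE; apply: bigsetU_measurable.
  - by rewrite inE; apply: measurableC; exact: measurable_gt.
  - rewrite -bigcup_mkord => w [c _ [cw fw]] /=; apply/negP; rewrite -leNgt.
    rewrite /prophet_max (has_arrivals0_count (ltW t0) cw).
    apply: bigmax_le => // i _; have := fw i (ltn_ord i).
    by rewrite /= in_itv.
have -> : - t * T x = - t + t * q by rewrite /q; ring.
rewrite expRD mulrC -ler_pdivlMr ?expR_gt0//.
apply: limr_le; first exact: is_cvg_series_exp_coeff.
by apply: nearW => n; rewrite ler_pdivlMr ?expR_gt0// mulrC.
Qed.

Lemma prophet_value_le t : 0 < t ->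
  (prophet_value P (fun k => Xs k : Omega -> R) (fun k => S k : Omega -> R) t <=
   (1 - primitive (fun x => expR (- t * T x)) 1)%:E)%E.
Proof.
move=> t0; rewrite /prophet_value unlock.
have mX : measurable_fun setT X by exact: measurable_funPT.
rewrite (@integral_unit _ _ _ _ (prophet_max t)); last first.
- exact: prophet_max_unit.
- exact: measurable_prophet_max.
rewrite lee_fin.
have := @primitive_affine_le R (fun x => expR (- t * T x)) (tail P (prophet_max t))
  0 1 (- 1) 1 (- 1) (unit_mfun_expR (ltW t0) (tail_unit_mfun P mX))
  (tail_unit_mfun P (measurable_prophet_max t)) (lexx 0) ler01.
rewrite !primitive0.
suff H : forall x, 0 < x -> x <= 1 ->
    - 1 + 1 * expR (- t * T x) <= - 1 * tail P (prophet_max t) x.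
  by move=> /(_ H); lra.
by move=> x x0 _; have := prophet_max_tail t0 (ltW x0); lra.
Qed.

(** * The gambler *)

(** For x > 0 the variable [Z] exceeds x exactly when D holds and X_{m+1} exceeds both x and theta.
    Its tail is thus P(D) T(max(x, theta)), which [primitive_comp_max] integrates. *)
Lemma integral_exceeding m D theta : independent_of_future m D ->
  0 <= theta <= 1 ->
  (\int[P]_(w in D `&` Xs m.+1 @^-1` `]theta, +oo[) (Xs m.+1 w)%:E =
   P D * (theta * T theta + excess T theta)%:E)%E.
Proof.
move=> indD theta01; have [mD _] := indD.
have mX : measurable_fun setT X by exact: measurable_funPT.
have mXm : measurable_fun setT (Xs m.+1) by exact: measurable_funPT.
set E := D `&` _.
have mE : measurable E.
  by apply: measurableI => //; rewrite -[_ @^-1` _]setTI; exact: mXm.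
pose Z w := Xs m.+1 w * \1_E w.
have mZ : measurable_fun setT Z.
  by apply: measurable_funM => //; exact: measurable_indic.
have Z01 w : 0 <= Z w <= 1.
  rewrite /Z indicE; case: (w \in E) => /=; rewrite ?mulr1 ?mulr0 ?lexx ?ler01//.
have -> : (\int[P]_(w in E) (Xs m.+1 w)%:E = \int[P]_w (Z w)%:E)%E.
  rewrite integral_mkcond; apply: eq_integral => w _.
  by rewrite patchE /Z indicE; case: ifP; rewrite ?mulr1 ?mulr0.
rewrite (integral_unit P mZ Z01).
have [pD PD] : exists pD, P D = pD%:E.
  by exists (fine (P D)); rewrite fineK// fin_num_measure.
have pD01 : 0 <= pD <= 1 by rewrite -!lee_fin -PD measure_ge0 probability_le1.
have [theta0 theta1] := andP theta01.
have tailZ x : 0 < x -> tail P Z x = pD * T (Num.max x theta).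
  move=> x0; apply: EFin_inj; rewrite tailK// EFinM -PD [T _]/T tailK//.
  have mgt : measurable (`]Num.max x theta, +oo[%classic : set R).
    exact: measurable_itv.
  have gtE (Y : Omega -> R) :
      [set w | Num.max x theta < Y w] = Y @^-1` `]Num.max x theta, +oo[.
    by apply/seteqP; split => w /=; rewrite in_itv/= andbT.
  rewrite gtE; have [<- _] := independent_of_future_next mgt indD.
  congr (P _); apply/seteqP; split => w /=; rewrite /Z indicE.
    case: (boolP (w \in E)) => [|_]; last by rewrite mulr0 ltNge (ltW x0).
    rewrite inE => -[Dw /=]; rewrite !in_itv/= !andbT mulr1 => tw xw.
    by split => //; rewrite gt_max xw.
  rewrite in_itv/= andbT => -[Dw]; rewrite gt_max => /andP[xw tw].
  by rewrite mem_set ?mulr1//; split => //=; rewrite in_itv/= tw.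
have uT := tail_unit_mfun P mX; have uZ := tail_unit_mfun P mZ.
have T01 x : 0 <= T x <= 1 by exact: tail_unit.
have Tni : nonincreasing_fun T by exact: tail_nonincreasing.
have um : unit_mfun (fun x => T (Num.max x theta)).
  apply: unit_mfun_nonincreasing => [x y xy|x]; last exact: T01.
  by apply: Tni; rewrite ge_max !le_max xy lexx orbT.
rewrite PD -EFinM /excess -primitive_comp_max//; congr EFin.
apply/le_anti/andP; split.
  have := @primitive_affine_le R _ _ 0 1 0 1 pD uZ um (lexx 0) ler01.
  rewrite !primitive0 !subr0 mul0r add0r mul1r; apply => x x0 _.
  by rewrite add0r mul1r tailZ.
have := @primitive_affine_le R _ _ 0 1 0 pD 1 um uZ (lexx 0) ler01.
rewrite !primitive0 !subr0 mul0r add0r mul1r; apply => x x0 _.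
by rewrite add0r mul1r tailZ.
Qed.

Fixpoint run_reward (l : seq R) m w : R :=
  if l is theta :: l' then
    if theta < Xs m.+1 w then Xs m.+1 w else run_reward l' m.+1 w
  else 0.

Lemma run_reward_ge0 l m w : 0 <= run_reward l m w.
Proof.
elim: l m => [//|theta l IH] m /=; case: ifP => // _.
by case/andP: (Xs01 m w).
Qed.

Lemma measurable_run_reward l m : measurable_fun setT (run_reward l m).
Proof.
elim: l m => [|theta l IH] m /=; first exact: measurable_cst.
have mX : measurable_fun setT (Xs m.+1) by exact: measurable_funPT.
by apply: measurable_fun_ifT => //; exact: measurable_fun_ltr.
Qed.

(** D is split by whether X_{m+1} exceeds the first threshold. The part where it does not is
    independent of the values after X_{m+1}, so the induction hypothesis applies to it. *)
Lemma integral_run_reward l m D : all (fun theta => 0 <= theta <= 1) l ->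
  independent_of_future m D ->
  (\int[P]_(w in D) (run_reward l m w)%:E = P D * (run_value T l)%:E)%E.
Proof.
elim: l m D => [|theta l IH] m D; first by move=> _ _; rewrite integral0 mule0.
move=> /= /andP[theta01 l01] indD; have [mD _] := indD.
have mgt : measurable (`]theta, +oo[%classic : set R) by exact: measurable_itv.
have mle : measurable (`]-oo, theta]%classic : set R) by exact: measurable_itv.
have [_ [mDgt _]] := independent_of_future_next mgt indD.
have [PDle indle] := independent_of_future_next mle indD.
have [mDle _] := indle.
have DE : D = (D `&` Xs m.+1 @^-1` `]theta, +oo[) `|`
    (D `&` Xs m.+1 @^-1` `]-oo, theta]).
  rewrite -setIUr -preimage_setU; apply/esym/setIidl => w _ /=.
  by rewrite !in_itv/= andbT; case: ltP; [left|right].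
rewrite {1}DE ge0_integral_setU//=; last 3 first.
- apply: measurable_funTS; apply/measurable_EFinP.
  exact: (measurable_run_reward (theta :: l) m).
- by move=> w _; rewrite lee_fin (run_reward_ge0 (theta :: l) m w).
- rewrite disj_set2E; apply/eqP/seteqP; split => // w /=.
  by rewrite !in_itv/= andbT => -[[_ lt_w] [_]]; rewrite leNgt lt_w.
have PD : P D \is a fin_num by exact: fin_num_measure.
rewrite EFinD muleDr// -(integral_exceeding indD)//; congr (_ + _)%E.
  apply: eq_integral => w; rewrite inE/= in_itv/= andbT => -[_ ->] //.
transitivity (\int[P]_(w in D `&` Xs m.+1 @^-1` `]-oo, theta])
    (run_reward l m.+1 w)%:E)%E.
  apply: eq_integral => w; rewrite inE/= in_itv/= => -[_].
  by rewrite leNgt => /negbTE ->.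
by rewrite IH// PDle cdf_tail EFinM muleA.
Qed.

(** * The threshold rule on the grid *)

Section grid_rule.
Variables (h : R) (th : seq R).
Hypotheses (h_gt0 : 0 < h) (th01 : all (fun theta => 0 <= theta <= 1) th).
Let n := size th.

(** Defined for every outcome, including several arrivals in one cell, as a stopping rule must be;
    the reward is evaluated only where each cell has at most one arrival. Position k stands for the
    arrival k + 1. *)
Definition grid_stop k w : bool :=
  has (fun i => (i%:R * h < S k.+1 w <= i.+1%:R * h) && (nth 0 th i < Xs k.+1 w))
    (iota 0 n).

(* Capped at n + 1, so as to be finite everywhere, not only almost surely. *)
Definition grid_rule w : nat := (find (grid_stop ^~ w) (iota 0 n)).+1.

Definition grid_reward w : R :=
  Xs (grid_rule w) w * (S (grid_rule w) w <= n%:R * h)%R%:R.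

Lemma grid_reward_ge0 w : 0 <= grid_reward w.
Proof.
rewrite mulr_ge0//.
by case/andP: (Xs01 (find (grid_stop ^~ w) (iota 0 n)) w).
Qed.

Lemma grid_stopE k w i : (i < n)%N -> i%:R * h < S k.+1 w <= i.+1%:R * h ->
  grid_stop k w = (nth 0 th i < Xs k.+1 w).
Proof.
move=> i_lt ik; apply/hasP/idP => [[j _ /andP[jk]]|lt_i]; last first.
  by exists i; rewrite ?mem_iota// ik.
suff -> : j = i by [].
have sub a b : a%:R * h < S k.+1 w <= a.+1%:R * h ->
    b%:R * h < S k.+1 w <= b.+1%:R * h -> (a <= b)%N.
  move=> /andP[ak _] /andP[_ kb]; have := lt_le_trans ak kb.
  by rewrite ltr_pM2r// ltr_nat ltnS.
by apply/eqP; rewrite eqn_leq !sub.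
Qed.

(** Induction over the cells: i cells have passed, m arrivals have occurred in them and none has
    stopped the rule. An empty cell advances i alone, a cell with one arrival advances both; m <= i
    keeps m within the n positions that the rule searches. *)
Lemma grid_reward_ge_run w c i m : n = (i + size c)%N -> (m <= i)%N ->
  S m w <= i%:R * h < S m.+1 w ->
  (forall j, (j < size c)%N -> has_arrivals (fun k => S k : Omega -> R)
     ((i + j)%:R * h) ((i + j).+1%:R * h) (nth false c j) w) ->
  (forall k, (k < m)%N -> ~~ grid_stop k w) ->
  run_reward (mask c (drop i th)) m w <= grid_reward w.
Proof.
elim: c i m => [|b c IH] i m nE mi Smi counts nostop /=.
  exact: grid_reward_ge0.
have i_lt : (i < n)%N by rewrite nE /= addnS ltnS leq_addr.
have nE' : n = (i.+1 + size c)%N by rewrite nE /= addnS addSn.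
have counts' j : (j < size c)%N -> has_arrivals (fun k => S k : Omega -> R)
    ((i.+1 + j)%:R * h) ((i.+1 + j).+1%:R * h) (nth false c j) w.
  by move=> jc; have := counts j.+1 jc; rewrite addnS addSn.
have ih : i%:R * h <= i.+1%:R * h by rewrite ler_wpM2r ?(ltW h_gt0)// ler_nat.
have := counts 0%N isT; rewrite addn0 /= => /(arrivals_next (S_lt ^~ w) Smi ih).
rewrite (drop_nth 0 i_lt); case: b {nE counts} => /=; last first.
  by rewrite addn0 => Smi'; apply: IH => //; exact: leqW.
rewrite addn1 => Smi'.
have stopE : grid_stop m w = (nth 0 th i < Xs m.+1 w).
  apply: grid_stopE => //.
  by case/andP: Smi => _ ->; case/andP: Smi' => ->.
case: ifPn => [lt_i|nlt_i]; last first.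
  apply: IH => // k; rewrite ltnS leq_eqVlt => /predU1P[->|]; last exact: nostop.
  by rewrite stopE.
have m_lt : (m < n)%N by exact: leq_ltn_trans i_lt.
have ruleE : grid_rule w = m.+1.
  rewrite /grid_rule; congr _.+1.
  rewrite -(subnKC (ltnW m_lt)) iotaD find_cat add0n.
  rewrite size_iota ifF; last first.
    apply/negbTE/hasPn => k; rewrite mem_iota => /andP[_]; exact: nostop.
  by rewrite -subnSK//= stopE lt_i addn0.
have in_time : S m.+1 w <= n%:R * h.
  case/andP: Smi' => /le_trans + _; apply.
  by rewrite ler_wpM2r ?(ltW h_gt0)// ler_nat.
by rewrite /grid_reward ruleE in_time mulr1.
Qed.

(** Stopping at position j is the preimage, under the pair formed by X_{j+1} and S_{j+1}, of a
    finite union of rectangles in the plane. *)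
Lemma grid_rule_stopping : stopping_rule (fun k => Xs k : Omega -> R)
  (fun k => S k : Omega -> R) grid_rule.
Proof.
split=> // -[|k].
  rewrite (_ : _ @^-1` _ = set0); first exact: (@measurable0 _ (g_sigma_algebraType _)).
  by apply/seteqP; split.
pose G := \big[setU/set0]_(j < k.+1) preimage_set_system setT
  (fun w => (Xs j.+1 w, S j.+1 w)) measurable.
have mstop j : (j <= k)%N ->
    measurable ([set w | grid_stop j w] : set (g_sigma_algebraType G)).
  move=> jk.
  have mB i : measurable ([set p : R * R | i%:R * h < p.2] `&`
      [set p : R * R | p.2 <= i.+1%:R * h] `&` [set p : R * R | nth 0 th i < p.1]).
    apply: measurableI; first apply: measurableI.
    - have := @measurable_snd _ _ R R measurableT _ (measurable_itv `]i%:R * h, +oo[).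
      by rewrite setTI; congr measurable;
        apply/seteqP; split => p /=; rewrite in_itv/= andbT.
    - have := @measurable_snd _ _ R R measurableT _ (measurable_itv `]-oo, i.+1%:R * h]).
      by rewrite setTI; congr measurable;
        apply/seteqP; split => p /=; rewrite in_itv.
    - have := @measurable_fst _ _ R R measurableT _ (measurable_itv `]nth 0 th i, +oo[).
      by rewrite setTI; congr measurable;
        apply/seteqP; split => p /=; rewrite in_itv/= andbT.
  apply: sub_sigma_algebra.
  rewrite /G (bigD1 (Ordinal (jk : (j < k.+1)%N)))//=; left.
  exists (\bigcup_(i in `I_n) ([set p : R * R | i%:R * h < p.2] `&`
      [set p : R * R | p.2 <= i.+1%:R * h] `&` [set p : R * R | nth 0 th i < p.1])).
    exact: bigcup_measurable.
  rewrite setTI; apply/seteqP; split => w /=.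
    move=> [i /= i_lt [[/= iS Si] iX]]; apply/hasP; exists i; first by rewrite mem_iota.
    by rewrite iS Si iX.
  move=> /hasP[i]; rewrite mem_iota add0n => /andP[_ i_lt] /andP[/andP[iS Si] iX].
  by exists i.
(* At k = n only the absence of an earlier stop is required, because of the cap; beyond n the event
   is empty. *)
rewrite (_ : _ @^-1` _ = if (k <= n)%N then
    (if (k < n)%N then [set w | grid_stop k w] else setT) `&`
    \bigcap_(j in `I_k) ~` [set w | grid_stop j w] else set0).
  case: ifP => kn; last exact: (@measurable0 _ (g_sigma_algebraType _)).
  apply: (@measurableI _ (g_sigma_algebraType G)).
    by case: ifP => _; [exact: mstop | exact: (@measurableT _ (g_sigma_algebraType _))].
  apply: (@bigcap_measurableType _ (g_sigma_algebraType G)) => j jk.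
  by apply: measurableC; apply: mstop; exact: ltnW.
apply/seteqP; split => w; rewrite /grid_rule /=.
  move=> [/find_iotaP[-> pk nop]]; split; first by case: ifP.
  by move=> j /= jk; apply/negP; exact: nop.
case: ifP => // kn [pk nop]; congr _.+1; apply/find_iotaP; split => // [kn'|j jk].
  by move: pk; rewrite kn'.
by apply/negP; exact: nop.
Qed.

Lemma measurable_grid_reward : measurable_fun setT grid_reward.
Proof.
apply: (@measurable_fun_select _ _ _ grid_rule
  (fun k w => Xs k w * (S k w <= n%:R * h)%R%:R)) => k.
  have [_ /(_ k)] := grid_rule_stopping.
  apply: smallest_sub; first exact: sigma_algebra_measurable.
  apply: (big_ind (fun A : set (set Omega) => A `<=` measurable)).
  - by [].
  - by move=> A B mA mB C [/mA|/mB].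
  - move=> j _ _ [B mB <-]; apply: measurable_fun_pair => //; exact: measurable_funPT.
apply: measurable_funM; first exact: measurable_funPT.
have mS : measurable [set w | S k w <= n%:R * h].
  have mSk : measurable_fun setT (S k) by exact: measurable_funPT.
  have := mSk measurableT _ (measurable_itv `]-oo, n%:R * h]).
  by rewrite setTI; congr measurable; apply/seteqP; split => w /=; rewrite in_itv.
apply: (eq_measurable_fun (\1_[set w | S k w <= n%:R * h] : Omega -> R)).
  by move=> w _; rewrite indicE; congr (nat_of_bool _)%:R; apply/idP/idP; rewrite inE.
exact: measurable_indic.
Qed.


(** The bits of the mask, coerced to 0 and 1, are the counts of the cells. *)
Definition grid_counts c : set Omega := \bigcap_(j in `I_n)
  has_arrivals (fun k => S k : Omega -> R) (j%:R * h) (j.+1%:R * h) (nth false c j).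

Lemma grid_counts_sigma c :
  g_sigma_seq (fun k => S k.+1 : Omega -> R) (grid_counts c).
Proof.
apply: (@bigcap_measurableType _ (g_sigma_algebraType _)) => j _.
apply: (g_sigma_seq_has_arrivals S0 S_lt); first by rewrite mulr_ge0// ltW.
by rewrite ler_wpM2r ?(ltW h_gt0)// ler_nat.
Qed.

Lemma prob_grid_counts c : size c = n -> P (grid_counts c) = (mask_weight h c)%:E.
Proof.
move=> cn; rewrite prob_arrivals_grid// /mask_weight (big_nth false) cn big_mkord.
congr EFin; apply: eq_bigr => j _; rewrite /poisson_pmf h_gt0 mulrC.
by case: nth; rewrite /= ?expr1 ?expr0 ?invr1 ?mulr1 ?mul1r.
Qed.

(** The reward is nonnegative, so its integral may be restricted to the disjoint events
    [grid_counts c]; on each it dominates [run_reward], whose integral is known. *)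
Lemma gambler_value_ge : ((masked_value T h th)%:E <=
  gambler_value P (fun k => Xs k : Omega -> R) (fun k => S k : Omega -> R)
    (n%:R * h))%E.
Proof.
apply: (@le_trans _ _ (\int[P]_w (grid_reward w)%:E)%E); last first.
  apply: ereal_sup_ubound; exists grid_rule; first exact: grid_rule_stopping.
  by rewrite unlock.
have mR := measurable_grid_reward.
have mA c : measurable (grid_counts c).
  exact: g_sigma_seq_measurable (grid_counts_sigma c).
have trivA : trivIset [set` masks n] grid_counts.
  move=> c c'; rewrite /= !mem_masks => /eqP cn /eqP c'n [w [cw c'w]].
  apply: (@eq_from_nth _ false); first by rewrite cn c'n.
  rewrite cn => j jn.
  have := card_II_inj (cw j jn) (c'w j jn).
  by case: nth; case: nth.
have mU : measurable (\big[setU/set0]_(c <- masks n) grid_counts c).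
  exact: bigsetU_measurable.
apply: (@le_trans _ _ (\int[P]_(w in \big[setU/set0]_(c <- masks n) grid_counts c)
    (grid_reward w)%:E)%E); last first.
  apply: ge0_subset_integral => //; first exact/measurable_EFinP.
  by move=> w _; rewrite lee_fin grid_reward_ge0.
rewrite ge0_integral_bigsetU//; last 3 first.
- exact: uniq_masks.
- by apply: measurable_funTS; exact/measurable_EFinP.
- by move=> w _; rewrite lee_fin grid_reward_ge0.
rewrite /masked_value -sumEFin big_seq [leRHS]big_seq; apply: lee_sum => c.
rewrite mem_masks => /eqP cn.
rewrite EFinM -prob_grid_counts// -(@integral_run_reward _ 0).
- apply: ge0_le_integral => //.
  + by move=> w _; rewrite lee_fin run_reward_ge0.
  + by apply: measurable_funTS; apply/measurable_EFinP; exact: measurable_run_reward.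
  + by apply: measurable_funTS; exact/measurable_EFinP.
  move=> w cw; rewrite lee_fin.
  have := @grid_reward_ge_run w c 0 0; rewrite drop0 mul0r; apply => //.
  + by rewrite S0 lexx /= -(S0 w) S_lt.
  + by move=> j; rewrite cn; exact: cw.
- by apply: all_mask.
- exact: arrivals_independent_of_future (grid_counts_sigma c).
Qed.

End grid_rule.

(** * The bound for a fixed grid and the passage to the upper limit *)

Lemma prophet_gambler_le n t : 0 < t -> t <= n%:R -> (1 < n)%N ->
  (prophet_value P (fun k => Xs k : Omega -> R) (fun k => S k : Omega -> R) t
   - gambler_value P (fun k => Xs k : Omega -> R) (fun k => S k : Omega -> R) t
   <= (hk_const R n + (2 + t) * t ^+ 2 / n%:R)%:E)%E.
Proof.
move=> t0 tn n1; set h := t / n%:R.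
have n0 : (0 : R) < n%:R by rewrite ltr0n (ltn_trans _ n1).
have nh : n%:R * h = t by rewrite mulrC divfK// gt_eqF.
have h0 : 0 < h by rewrite divr_gt0.
have h01 : 0 <= h <= 1 by rewrite (ltW h0)/= ler_pdivrMr// mul1r.
have mX : measurable_fun setT X by exact: measurable_funPT.
have T01 x : 0 <= T x <= 1 by exact: tail_unit.
have Tni : nonincreasing_fun T by exact: tail_nonincreasing.
have := gambler_value_ge h0 (thresholds_unit Tni T01 n h01).
rewrite size_thresholds nh => gambler_ge.
have le_t : n%:R * h <= t by rewrite nh.
have := masked_value_ge Tni T01 h01 le_t; rewrite -lee_fin => value_ge.
have t_n : 0 <= t <= n%:R by rewrite (ltW t0).
have := tail_certificate Tni T01 n1 t_n; rewrite -lee_fin => certificate.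
apply: le_trans (leeB (le_trans (prophet_value_le t0) certificate)
  (le_trans value_ge gambler_ge)) _.
rewrite -EFinB lee_fin -/h.
have -> : n%:R * (2 + t) * h ^+ 2 = (2 + t) * t ^+ 2 / n%:R.
  by rewrite /h; field; rewrite gt_eqF.
by lra.
Qed.

End model.

(** [limn_esup] is an infimum of suprema over the neighbourhoods of infinity, so for each e > 0 it
    suffices to find in each neighbourhood one large index n with K / n <= e. *)
Lemma limn_esup_ge (R : realType) (u : nat -> \bar R) (l : \bar R) (K : R) :
  (\forall n \near \oo, (l <= u n + (K / n%:R)%:E)%E) -> (l <= limn_esup u)%E.
Proof.
move=> [N _ lu]; apply/lee_addgt0Pr => e e0.
rewrite -leeBlDr//; apply: le_ereal_inf_tmp => _ [A [N' _ AN'] <-].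
(* Beyond N the hypothesis holds, beyond N' the index lies in A, and beyond |K / e| the error is at
   most e; the successor keeps m positive. *)
pose m := (maxn N N' + (Num.bound `|K / e|).+1)%N.
have Nm : (N <= m)%N by rewrite (leq_trans (leq_maxl N N'))// leq_addr.
have N'm : (N' <= m)%N by rewrite (leq_trans (leq_maxr N N'))// leq_addr.
have Km : K / m%:R <= e.
  have m0 : (0 : R) < m%:R by rewrite ltr0n /m addnS.
  rewrite ler_pdivrMr// mulrC -ler_pdivrMr//.
  apply: le_trans (ler_norm _) _; apply: ltW.
  apply: lt_le_trans (archi_boundP (normr_ge0 (K / e))) _.
  by rewrite ler_nat /m addnS (leq_trans (leq_addl (maxn N N') _))// leqW.
rewrite leeBlDr//; apply: le_trans (lu m Nm) _; apply: leeD; last by rewrite lee_fin.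
by apply: ereal_sup_ubound; exists m => //; exact: AN'.
Qed.

Theorem theorem3p3 (R : realType) (d : measure_display)
    (Omega : measurableType d) (P : probability Omega R)
    (X : {RV P >-> R}) (Xs S : nat -> {RV P >-> R})
    (X01 : forall w, 0 <= X w <= 1)
    (Xs01 : forall k w, 0 <= Xs k.+1 w <= 1)
    (Xs_law : forall k (B : set R), measurable B ->
      P (Xs k.+1 @^-1` B) = P (X @^-1` B))
    (Xs_indep : mutually_independent P (fun k => Xs k.+1 : Omega -> R))
    (X_neq0 : (P (X @^-1` [set 0%R]) < 1)%E)
    (S_poisson : poisson_arrivals P 1 (fun k => S k : Omega -> R))
    (SX_indep : independent_seqs P (fun k => S k.+1 : Omega -> R)
                  (fun k => Xs k.+1 : Omega -> R)) :
  forall t : R, 0 < t ->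
    (prophet_value P (fun k => Xs k : Omega -> R) (fun k => S k : Omega -> R) t
     - gambler_value P (fun k => Xs k : Omega -> R) (fun k => S k : Omega -> R) t
     <= limn_esup (fun n => (hk_const R n)%:E))%E.
Proof.
move=> t t0; apply: (@limn_esup_ge _ _ _ ((2 + t) * t ^+ 2)).
near=> n; rewrite -EFinD; apply: (@prophet_gambler_le _ _ _ P X) => //; last first.
  by near: n; exact: nbhs_infty_gt.
by near: n; exact: nbhs_infty_ger.
Unshelve. all: by end_near. Qed.
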